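(* For every fixed nonnegative integer $r$, there exists $N=N(r)$ such that if $M$ is a matroid of rank $r$ on $n\ge N$ elements, then monotonicity holds for $M$.
   Context: Matroid bingo: let $M$ be a matroid on a finite set $E$ with $|E|=n$ and circuit set $\mathcal{C}$. The elements of $E$ are called out one at a time in a uniformly random order $\sigma(1),\sigma(2),\dots,\sigma(n)$ (a uniformly random permutation of $E$). A circuit $C$ wins in round $t$ if $C\subseteq\{\sigma(1),\dots,\sigma(t)\}$ and no circuit of $M$ is contained in $\{\sigma(1),\dots,\sigma(t-1)\}$; thus the winner is the first circuit to be completed (the circuit axioms guarantee that there is no tie). $\beta_C$ denotes the probability that $C$ wins (in some round). Monotonicity holds for $M$ if $\beta_{C_1}<\beta_{C_2}$ whenever $C_1,C_2$ are circuits of $M$ with $|C_1|>|C_2|$. *)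

(* Defs.v *)
From HB Require Import structures.
From mathcomp Require Import all_boot all_order all_algebra.
Set Implicit Arguments.
Unset Strict Implicit.
Unset Printing Implicit Defensive.
Import Order.TTheory GRing.Theory Num.Theory.

(* The ground set is the whole finite type T. *)
Record matroid (T : finType) := Matroid {
  indep : pred {set T};
  indep0 : indep set0;
  indepS : forall I J : {set T}, J \subset I -> indep I -> indep J;
  indep_augment : forall I J : {set T}, indep I -> indep J -> #|I| < #|J| ->
    exists2 x, x \in J :\: I & indep (x |: I)
}.

Definition circuit (T : finType) (M : matroid T) (C : {set T}) : bool :=
  minset (fun A => ~~ indep M A) C.

Definition rank (T : finType) (M : matroid T) : nat :=
  \max_(I : {set T} | indep M I) #|I|.

(* An injective s : {ffun 'I_#|T| -> T} is a bijection, hence an order on T.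
   Positions are numbered from 0: s i is the element called in round i + 1. *)
Definition orders (T : finType) : {set {ffun 'I_#|T| -> T}} :=
  [set s : {ffun 'I_#|T| -> T} | injectiveb s].

Definition called (T : finType) (s : {ffun 'I_#|T| -> T}) (t : nat) : {set T} :=
  [set s i | i : 'I_#|T| & (i < t)%N].

Definition wins_in_round (T : finType) (M : matroid T)
    (s : {ffun 'I_#|T| -> T}) (C : {set T}) (t : nat) : bool :=
  (C \subset called s t)
  && ~~ [exists D : {set T}, circuit M D && (D \subset called s t.-1)].

(* The rounds 1, ..., n are the i.+1 for i : 'I_n. *)
Definition wins (T : finType) (M : matroid T)
    (s : {ffun 'I_#|T| -> T}) (C : {set T}) : bool :=
  [exists i : 'I_#|T|, wins_in_round M s C i.+1].

Definition beta (T : finType) (M : matroid T) (C : {set T}) : rat :=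
  (#|[set s in orders T | wins M s C]|%:R / #|orders T|%:R)%R.

Definition monotonicity (T : finType) (M : matroid T) : Prop :=
  forall C1 C2 : {set T}, circuit M C1 -> circuit M C2 -> #|C2| < #|C1| ->
    (beta M C1 < beta M C2)%R.

(* Main.v *)
Require Import Defs.
From HB Require Import structures.
From mathcomp Require Import all_boot all_order all_algebra.
From mathcomp Require Import fingroup perm.
From mathcomp Require Import zify.
Set Implicit Arguments.
Unset Strict Implicit.
Unset Printing Implicit Defensive.

(** A winning circuit must be contained in the first [r + 1] called elements,
    because the elements called before the winning round are independent.
    Hence [beta M C1 <= 2 ^ (r + 1) / 'C(n, k1)] with [k1 = #|C1|], by a union
    bound over the set of positions of [C1].  On the other hand [C2] wins as soon
    as its elements are the first ones called, so [1 / 'C(n, k2) <= beta M C2]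
    with [k2 = #|C2|].  If [k2 < k1 <= r + 1] then ['C(n, k1) / 'C(n, k2)] tends
    to infinity with [n], uniformly in [k1] and [k2]. *)

(** List [A] followed by its complement, and likewise [B]. Matching the two lists index by index
    permutes [T], and since [A] and [B] have equal size their initial blocks correspond. *)
Lemma perm_imset_exists (T : finType) (A B : {set T}) :
  #|A| = #|B| -> exists p : {perm T}, p @: A = B.
Proof.
move=> eqAB; pose e (X : {set T}) := enum X ++ enum (~: X).
have uniq_e X : uniq (e X).
  rewrite cat_uniq !enum_uniq andbT /=; apply/hasPn => x.
  by rewrite !mem_enum inE.
have mem_e X x : x \in e X by rewrite mem_cat !mem_enum inE orbN.
have size_e X : size (e X) = #|T| by rewrite size_cat -!cardE cardsC.
have lt_index x : index x (e A) < size (e B).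
  by rewrite size_e -(size_e A) index_mem.
pose f x := nth x (e B) (index x (e A)).
have inj_f : injective f.
  (* The default in [f x] is [x] itself, so both values are brought to a common default before
     uniqueness of [e B] applies. *)
  move=> x y; rewrite /f (set_nth_default x y) // => /eqP.
  by rewrite nth_uniq // => /eqP; apply: index_inj.
exists (perm inj_f); apply/eqP; rewrite eqEcard card_imset; last exact: perm_inj.
rewrite eqAB leqnn andbT; apply/subsetP => _ /imsetP[x xA ->].
rewrite permE /f /e index_cat mem_enum xA nth_cat.
have lt_x : index x (enum A) < size (enum B).
  by rewrite -cardE -eqAB cardE index_mem mem_enum.
by rewrite lt_x -mem_enum mem_nth.
Qed.

Lemma card_orders (T : finType) : #|orders T| = #|T|`!.
Proof. by rewrite /orders card_inj_ffuns card_ord ffactnn. Qed.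

Definition orders_at (T : finType) (J : {set 'I_#|T|}) (C : {set T}) :
    {set {ffun 'I_#|T| -> T}} :=
  [set s in orders T | s @: J == C].

(** Relabelling the called elements by a permutation that carries [C] to [D] is injective on
    orders. *)
Lemma leq_card_orders_at (T : finType) (J : {set 'I_#|T|}) (C D : {set T}) :
  #|C| = #|D| -> #|orders_at J C| <= #|orders_at J D|.
Proof.
case/perm_imset_exists=> p pC.
pose g (s : {ffun 'I_#|T| -> T}) := [ffun i => p (s i)].
have inj_g : injective g.
  move=> s1 s2 /ffunP eq_g; apply/ffunP => i.
  by have := eq_g i; rewrite !ffunE; apply: perm_inj.
rewrite -(card_imset _ inj_g); apply/subset_leq_card/subsetP => _ /imsetP[s + ->].
rewrite !inE => /andP[/injectiveP inj_s /eqP sJ]; apply/andP; split.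
  by apply/injectiveP => i j; rewrite !ffunE => /perm_inj /inj_s.
apply/eqP; rewrite -pC -sJ -imset_comp.
by apply: eq_imset => i; rewrite ffunE.
Qed.

(** The image of [J] sorts the orders into one class per set of size [#|C|]. By relabelling, all
    classes have the same size. *)
Lemma card_orders_at (T : finType) (J : {set 'I_#|T|}) (C : {set T}) :
  #|J| = #|C| -> #|orders_at J C| * 'C(#|T|, #|C|) = #|T|`!.
Proof.
move=> eqJC; rewrite -card_orders -card_draws mulnC -sum_nat_const.
rewrite -[RHS]sum1_card.
rewrite (partition_big (fun s : {ffun _} => s @: J)
  (mem [set D : {set T} | #|D| == #|C|])) /=.
  apply: eq_bigr => D; rewrite inE => /eqP eqDC.
  rewrite sum1dep_card; apply/eqP; rewrite eqn_leq /orders_at.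
  by rewrite !leq_card_orders_at.
move=> s; rewrite !inE => /injectiveP inj_s.
by rewrite card_imset // eqJC.
Qed.

Lemma card_ord_lt (n t : nat) : t <= n -> #|[set i : 'I_n | i < t]| = t.
Proof.
move=> le_tn; rewrite -[RHS]card_ord -cardsT.
have inj_w : injective (widen_ord le_tn) by move=> i j [] /val_inj.
rewrite -(card_imset _ inj_w).
apply: eq_card => i; rewrite inE; apply/idP/imsetP => [lt_it | [j _ ->]].
  by exists (Ordinal lt_it); rewrite ?inE //; apply: val_inj.
exact: ltn_ord j.
Qed.

Lemma called_imset (T : finType) (s : {ffun 'I_#|T| -> T}) (t : nat) :
  called s t = s @: [set i : 'I_#|T| | i < t].
Proof.
apply/setP => x; apply/imsetP/imsetP => -[i lt_it ->];
  by exists i; rewrite ?inE // in lt_it *.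
Qed.

Lemma card_called (T : finType) (s : {ffun 'I_#|T| -> T}) (t : nat) :
  s \in orders T -> t <= #|T| -> #|called s t| = t.
Proof.
rewrite inE => /injectiveP inj_s le_t.
by rewrite called_imset card_imset // card_ord_lt.
Qed.

Lemma subset_called (T : finType) (s : {ffun 'I_#|T| -> T}) (t u : nat) :
  t <= u -> called s t \subset called s u.
Proof.
move=> le_tu; rewrite !called_imset; apply/imsetS/subsetP => i; rewrite !inE.
by move/leq_trans; apply.
Qed.

Lemma indep_leq_rank (T : finType) (M : matroid T) (A : {set T}) :
  indep M A -> #|A| <= rank M.
Proof. by move=> indA; rewrite /rank (leq_bigmax_cond (P := indep M)). Qed.

Lemma indep_circuit_free (T : finType) (M : matroid T) (A : {set T}) :
  ~~ [exists D : {set T}, circuit M D && (D \subset A)] -> indep M A.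
Proof.
apply: contraNT => depA; apply/existsP.
by have [D minD sDA] := minset_exists (P := fun A => ~~ indep M A) depA; exists D; apply/andP.
Qed.

Lemma circuit_card_gt0 (T : finType) (M : matroid T) (C : {set T}) :
  circuit M C -> 0 < #|C|.
Proof.
move=> /minsetp depC; rewrite card_gt0; apply: contraNneq depC => ->.
exact: indep0.
Qed.

Lemma circuit_leq_rank (T : finType) (M : matroid T) (C : {set T}) :
  circuit M C -> #|C| <= (rank M).+1.
Proof.
move=> circC; have /card_gt0P[x xC] := circuit_card_gt0 circC.
rewrite (cardsD1 x) xC ltnS; apply: indep_leq_rank; apply/negPn/negP => dep.
have := minsetinf circC dep (subD1set C x).
by move/setP/(_ x); rewrite !inE eqxx xC.
Qed.

Lemma wins_subset_called (T : finType) (M : matroid T) s (C : {set T}) :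
  s \in orders T -> wins M s C -> C \subset called s (rank M).+1.
Proof.
move=> ord_s /existsP[i /andP[sC /indep_circuit_free ind]].
apply: subset_trans sC (subset_called _ _).
(* Exactly [i] elements are called before round [i.+1]; being independent, they number at most
   [rank M]. *)
by have := indep_leq_rank ind; rewrite /= card_called // ltnW.
Qed.

(** A circuit completed before round [#|C|] would lie in [C], hence equal [C] by minimality, but
    fewer than [#|C|] elements have been called by then. *)
Lemma called_wins (T : finType) (M : matroid T) s (C : {set T}) :
  s \in orders T -> circuit M C -> called s #|C| = C -> wins M s C.
Proof.
move=> ord_s circC calC; have C_gt0 := circuit_card_gt0 circC.
have lt_i : #|C|.-1 < #|T| by rewrite prednK // max_card.
apply/existsP; exists (Ordinal lt_i); rewrite /wins_in_round /= prednK //.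
rewrite calC subxx; apply/existsP => -[D /andP[circD sD]].
have sDC : D \subset C.
  by rewrite -calC (subset_trans sD) // subset_called // leq_pred.
have eqDC := minsetinf circC (minsetp circD) sDC.
have := subset_leq_card sD; rewrite eqDC card_called //; last exact: ltnW.
by rewrite -ltnS prednK // ltnn.
Qed.

Definition winning_orders (T : finType) (M : matroid T) (C : {set T}) :=
  [set s in orders T | wins M s C].

Lemma card_winning_orders_lower (T : finType) (M : matroid T) (C : {set T}) :
  circuit M C -> #|T|`! <= #|winning_orders M C| * 'C(#|T|, #|C|).
Proof.
move=> circC; rewrite -(@card_orders_at _ [set i : 'I_#|T| | i < #|C|] C); last first.
  by rewrite card_ord_lt // max_card.
rewrite leq_mul2r subset_leq_card ?orbT //; apply/subsetP => s.
rewrite !in_set => /andP[inj_s /eqP sC]; rewrite inj_s /=.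
by apply: called_wins => //; rewrite ?inE // called_imset.
Qed.

Lemma card_winning_orders_upper (T : finType) (M : matroid T) (C : {set T}) :
  (rank M).+1 <= #|T| ->
  #|winning_orders M C| * 'C(#|T|, #|C|) <= 2 ^ (rank M).+1 * #|T|`!.
Proof.
move=> le_rT; pose P := [set i : 'I_#|T| | i < (rank M).+1].
pose Js := [set J in powerset P | #|J| == #|C|].
have sub : winning_orders M C \subset \bigcup_(J in Js) orders_at J C.
  apply/subsetP => s; rewrite inE => /andP[ord_s win].
  have := wins_subset_called ord_s win; rewrite called_imset => sC.
  have inj_s : injective s by move: ord_s; rewrite inE => /injectiveP.
  have img : s @: (s @^-1: C) = C.
    apply/setP => x; apply/imsetP/idP => [[i] | xC]; first by rewrite inE => ? ->.
    by have /imsetP[i _ xE] := subsetP sC x xC; exists i; rewrite // inE -xE.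
  (* The witness is the set of positions at which [C] is called. *)
  apply/bigcupP; exists (s @^-1: C); last by rewrite inE ord_s img /=.
  have card_pre : #|s @^-1: C| = #|C| by rewrite -[in RHS]img card_imset.
  rewrite in_set powersetE card_pre eqxx andbT.
  apply/subsetP => i; rewrite inE => /(subsetP sC) /imsetP[j jP /inj_s ->] //.
apply: leq_trans (_ : #|Js| * #|T|`! <= _); last first.
  rewrite leq_mul2r; apply/orP; right.
  rewrite -[in leqRHS](card_ord_lt le_rT) -card_powerset.
  by apply/subset_leq_card/subsetP => J; rewrite inE => /andP[].
rewrite -[leqRHS]sum_nat_const.
apply: leq_trans (_ : (\sum_(J in Js) #|orders_at J C|) * 'C(#|T|, #|C|) <= _).
  rewrite leq_mul2r (leq_trans (subset_leq_card sub)) ?orbT //.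
  elim/big_rec2: _ => [|J m U _ le_U]; first by rewrite cards0.
  by rewrite (leq_trans (leq_card_setU _ _)) // leq_add2l.
rewrite big_distrl /= leq_sum // => J; rewrite inE => /andP[_ /eqP eqJ].
by rewrite card_orders_at.
Qed.

(** For [j < m] the ratio of ['C(n, j.+1)] to ['C(n, j)] is [(n - j) / (j + 1)], which exceeds [a]
    because [n - j > a * m]. One such step gains the factor [a], and further steps keep it since
    [a >= 1]. *)
Lemma bin_growth (a n k l m : nat) :
  0 < a -> k < l <= m -> m + a * m <= n -> a * 'C(n, k) < 'C(n, l).
Proof.
move=> a_gt0 /andP[lt_kl le_lm] le_n.
have step j : j < m -> a * 'C(n, j) < 'C(n, j.+1).
  move=> lt_jm; rewrite -(ltn_pmul2l (ltn0Sn j)) mul_bin_left.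
  have bin0 : 0 < 'C(n, j) by rewrite bin_gt0; nia.
  rewrite mulnA ltn_pmul2r //; nia.
elim: l lt_kl le_lm => // l IH; rewrite ltnS leq_eqVlt => /orP[/eqP <- | lt_kl] lt_lm.
  exact: step.
apply: ltn_trans (IH lt_kl (ltnW lt_lm)) _.
apply: leq_ltn_trans (step l lt_lm); exact: leq_pmull.
Qed.

Theorem theorem8 :
  forall r : nat, exists N : nat,
    forall (T : finType) (M : matroid T),
      rank M = r -> N <= #|T| -> monotonicity M.
Proof.
(* This is the bound [m + a * m] of [bin_growth] with [m = r.+1], the largest circuit size, and
   [a = 2 ^ r.+1], the loss in the union bound. *)
move=> r; exists (r.+1 + 2 ^ r.+1 * r.+1) => T M rM le_N C1 C2 circ1 circ2 lt_C.
have le_rT : (rank M).+1 <= #|T| by rewrite rM; lia.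
have upper := card_winning_orders_upper C1 le_rT.
have lower := card_winning_orders_lower circ2.
have growth : 2 ^ r.+1 * 'C(#|T|, #|C2|) < 'C(#|T|, #|C1|).
  apply: bin_growth le_N; first by rewrite expn_gt0.
  by rewrite lt_C -rM circuit_leq_rank.
rewrite /beta card_orders Num.Theory.ltr_pM2r; last first.
  by rewrite Num.Theory.invr_gt0 Num.Theory.ltr0n fact_gt0.
rewrite Num.Theory.ltr_nat -/(winning_orders M C1) -/(winning_orders M C2).
have w2_gt0 : 0 < #|winning_orders M C2|.
  by rewrite lt0n; apply: contraTneq lower => ->; rewrite -ltnNge fact_gt0.
rewrite rM in upper.
(* Multiplied by ['C(#|T|, #|C1|)], the claim follows by chaining [upper], [lower] and [growth];
   [w2_gt0] keeps the last inequality strict. *)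
rewrite -(ltn_pmul2r (leq_ltn_trans (leq0n _) growth)).
apply: leq_ltn_trans upper _.
apply: leq_ltn_trans (leq_mul (leqnn _) lower) _.
by rewrite mulnCA ltn_pmul2l.
Qed.
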